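(* Let $\mathcal{V}$ be a variety of algebras of finite type, whose language contains at least one constant symbol, such that $\mathbb{S}(\mathcal{V}_{SI})\subseteq\mathcal{V}_{DI}$, i.e. every subalgebra of every subdirectly irreducible member of $\mathcal{V}$ is directly indecomposable. Then $\mathcal{V}$ is a Pierce variety if and only if $\mathcal{V}$ is coextensive.
   Context: Finite type: finitely many operation symbols. $\mathcal{V}_{SI}$ and $\mathcal{V}_{DI}$ denote the classes of subdirectly irreducible and of directly indecomposable members of $\mathcal{V}$; $\mathbb{S}(\mathcal{K})$ is the class of subalgebras of members of $\mathcal{K}$. An algebra is directly indecomposable if it is not isomorphic to a product of two nontrivial algebras. A variety $\mathcal{V}$ is a Pierce variety if there are $N\geq 1$, $0$-ary (closed) terms $0_1,\dots,0_N,1_1,\dots,1_N$ and a term $U(x,y,\vec{z},\vec{w})$ ($\vec z,\vec w$ of length $N$) such that $\mathcal{V}$ satisfies the identities $U(x,y,\vec{0},\vec{1})=x$ and $U(x,y,\vec{1},\vec{0})=y$. A category $\mathcal{C}$ with finite products is coextensive if for all objects $X,Y$ the canonical functor $\times: X/\mathcal{C}\times Y/\mathcal{C}\to (X\times Y)/\mathcal{C}$ between coslice categories is an equivalence. A variety is coextensive if, as a category with all homomorphisms as arrows, it is coextensive. *)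

(* Defs.v *)
From mathcomp Require Import all_boot.
From mathcomp Require Import boolp.

Set Implicit Arguments.
Unset Strict Implicit.
Unset Printing Implicit Defensive.

(* A similarity type with finitely many operation symbols, of finite arities. *)
Record signature := Signature {
  symb : finType;
  arity : symb -> nat }.

(* No nonemptiness is required of carriers: it is automatic as soon as the
   signature has a constant symbol. *)
Record algebra (Sg : signature) := Algebra {
  carrier :> Type;
  op : forall s : symb Sg, ('I_(arity s) -> carrier) -> carrier }.
Arguments op {Sg a} s args.

Section Morphisms.
Variable Sg : signature.
Implicit Types A B C : algebra Sg.

Definition is_hom A B (f : A -> B) : Prop :=
  forall (s : symb Sg) (a : 'I_(arity s) -> A),
    f (op s a) = op s (fun i => f (a i)).

Record homomorphism A B := Homomorphism {
  hom_fun :> A -> B;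
  hom_funP : is_hom hom_fun }.

Lemma homomorphism_eq A B (f g : homomorphism A B) : f =1 g -> f = g.
Proof.
case: f g => f hf [g hg] /= /funext fg; move: hf; rewrite fg => hf.
by congr Homomorphism; apply: Prop_irrelevance.
Qed.

Lemma id_is_hom A : is_hom (@id A).
Proof. by []. Qed.

Definition id_hom A : homomorphism A A := Homomorphism (@id_is_hom A).

Lemma comp_is_hom A B C (g : homomorphism B C) (f : homomorphism A B) :
  is_hom (g \o f).
Proof. by move=> s a /=; rewrite !hom_funP. Qed.

Definition comp_hom A B C (g : homomorphism B C) (f : homomorphism A B) :
  homomorphism A C := Homomorphism (comp_is_hom g f).

Definition is_isomorphism A B (f : homomorphism A B) : Prop :=
  exists g : homomorphism B A, cancel f g /\ cancel g f.

Definition isomorphic A B : Prop :=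
  exists f : homomorphism A B, is_isomorphism f.

End Morphisms.

Section Constructions.
Variable Sg : signature.
Implicit Types A B : algebra Sg.

Record subuniverse A := Subuniverse {
  sub_mem :> A -> Prop;
  sub_closed : forall (s : symb Sg) (a : 'I_(arity s) -> A),
    (forall i, sub_mem (a i)) -> sub_mem (op s a) }.

Definition subalgebra A (P : subuniverse A) : algebra Sg :=
  @Algebra Sg {x : A | P x}
    (fun s a => exist P (op s (fun i => sval (a i)))
                        (sub_closed (fun i => svalP (a i)))).

Definition trivial_algebra : algebra Sg := @Algebra Sg unit (fun _ _ => tt).

Definition prod_algebra A B : algebra Sg :=
  @Algebra Sg (A * B)%type
    (fun s a => (op s (fun i => (a i).1), op s (fun i => (a i).2))).

Definition big_prod_algebra (I : Type) (B : I -> algebra Sg) : algebra Sg :=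
  @Algebra Sg (forall i, B i) (fun s a i => op s (fun k => a k i)).

Definition nontrivial A : Prop := exists x y : A, x <> y.

Definition directly_indecomposable A : Prop :=
  ~ exists B C, [/\ nontrivial B, nontrivial C & isomorphic A (prod_algebra B C)].

Definition subdirect_embedding A (I : Type) (B : I -> algebra Sg)
    (f : homomorphism A (big_prod_algebra B)) : Prop :=
  injective f /\ forall i (b : B i), exists a, f a i = b.

Lemma proj_is_hom (I : Type) (B : I -> algebra Sg) (i : I) :
  is_hom (A := big_prod_algebra B) (B := B i) (fun b => b i).
Proof. by []. Qed.

Definition proj_hom (I : Type) (B : I -> algebra Sg) (i : I) :
  homomorphism (big_prod_algebra B) (B i) := Homomorphism (@proj_is_hom I B i).

(* The index type may be empty, so one-element algebras are excluded. *)
Definition subdirectly_irreducible A : Prop :=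
  forall (I : Type) (B : I -> algebra Sg)
         (f : homomorphism A (big_prod_algebra B)),
    subdirect_embedding f ->
    exists i, is_isomorphism (comp_hom (proj_hom B i) f).

End Constructions.

Inductive term (Sg : signature) (X : Type) : Type :=
| Var of X
| App (s : symb Sg) of ('I_(arity s) -> term Sg X).
Arguments Var {Sg X} x.
Arguments App {Sg X} s args.

Section Terms.
Variable Sg : signature.

Fixpoint eval (A : algebra Sg) X (e : X -> A) (t : term Sg X) : A :=
  match t with
  | Var x => e x
  | App s args => op s (fun i => eval e (args i))
  end.

Fixpoint subst X Y (sigma : X -> term Sg Y) (t : term Sg X) : term Sg Y :=
  match t with
  | Var x => sigma x
  | App s args => App s (fun i => subst sigma (args i))
  end.

Definition closed_term := term Sg void.

Definition closed_in X (t : closed_term) : term Sg X := subst (of_void _) t.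

Definition satisfies (A : algebra Sg) X (s t : term Sg X) : Prop :=
  forall e : X -> A, eval e s = eval e t.

(* Varieties are the equational classes, with variables indexed by nat. *)
Record variety := Variety {
  in_variety :> algebra Sg -> Prop;
  variety_equational : exists E : term Sg nat -> term Sg nat -> Prop,
    forall A, in_variety A <-> forall s t, E s t -> satisfies A s t }.

Definition variety_satisfies (V : variety) X (s t : term Sg X) : Prop :=
  forall A, V A -> satisfies A s t.

Definition SI_members (V : variety) (A : algebra Sg) : Prop :=
  V A /\ subdirectly_irreducible A.

Definition DI_members (V : variety) (A : algebra Sg) : Prop :=
  V A /\ directly_indecomposable A.

Inductive class_S (K : algebra Sg -> Prop) : algebra Sg -> Prop :=
| Class_S A (P : subuniverse A) of K A : class_S K (subalgebra P).

Inductive U_var (N : nat) := Ux | Uy | Uz of 'I_N | Uw of 'I_N.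

Definition subst_U N Y (U : term Sg (U_var N)) (x y : term Sg Y)
    (z w : 'I_N -> term Sg Y) : term Sg Y :=
  subst (fun v => match v with
                  | Ux => x
                  | Uy => y
                  | Uz i => z i
                  | Uw i => w i
                  end) U.

(* The two variables of the identities are true (for x) and false (for y). *)
Definition Pierce (V : variety) : Prop :=
  exists (N : nat) (zero one : 'I_N -> closed_term) (U : term Sg (U_var N)),
    let x := Var true in
    let y := Var false in
    let zeros i := closed_in bool (zero i) in
    let ones i := closed_in bool (one i) in
    [/\ 1 <= N,
        variety_satisfies V (subst_U U x y zeros ones) x
      & variety_satisfies V (subst_U U x y ones zeros) y].

End Terms.

Record category := Category {
  obj :> Type;
  hom : obj -> obj -> Type;
  idm : forall a, hom a a;
  comp : forall a b c, hom b c -> hom a b -> hom a c;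
  comp_assoc : forall a b c d (h : hom c d) (g : hom b c) (f : hom a b),
    comp h (comp g f) = comp (comp h g) f;
  comp_idl : forall a b (f : hom a b), comp (idm b) f = f;
  comp_idr : forall a b (f : hom a b), comp f (idm a) = f }.
Arguments hom {_} a b : rename.
Arguments idm {_} a : rename.
Arguments comp {_ _ _ _} g f : rename.

Record functor (C D : category) := Functor {
  fobj :> C -> D;
  fmap : forall a b : C, hom a b -> hom (fobj a) (fobj b);
  fmap_id : forall a, fmap (idm a) = idm (fobj a);
  fmap_comp : forall a b c (g : hom b c) (f : hom a b),
    fmap (comp g f) = comp (fmap g) (fmap f) }.
Arguments fmap {C D} f {a b} h : rename.

Definition id_functor (C : category) : functor C C :=
  @Functor C C id (fun _ _ => id) (fun _ => erefl) (fun _ _ _ _ _ => erefl).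

Section Functors.

Lemma comp_functor_id (C D E : category) (G : functor D E) (F : functor C D) a :
  fmap G (fmap F (idm a)) = idm (G (F a)).
Proof. by rewrite !fmap_id. Qed.

Lemma comp_functor_comp (C D E : category) (G : functor D E) (F : functor C D)
    a b c (g : hom b c) (f : hom a b) :
  fmap G (fmap F (comp g f)) = comp (fmap G (fmap F g)) (fmap G (fmap F f)).
Proof. by rewrite !fmap_comp. Qed.

Definition comp_functor (C D E : category) (G : functor D E) (F : functor C D) :
  functor C E :=
  @Functor C E (fun a => G (F a)) (fun _ _ f => fmap G (fmap F f))
    (@comp_functor_id _ _ _ G F) (@comp_functor_comp _ _ _ G F).

Definition is_iso (C : category) (a b : C) (f : hom a b) : Prop :=
  exists g : hom b a, comp g f = idm a /\ comp f g = idm b.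

Definition naturally_isomorphic (C D : category) (F G : functor C D) : Prop :=
  exists eta : forall a : C, hom (F a) (G a),
    (forall a, is_iso (eta a)) /\
    (forall a b (f : hom a b), comp (fmap G f) (eta a) = comp (eta b) (fmap F f)).

Definition is_equivalence (C D : category) (F : functor C D) : Prop :=
  exists G : functor D C,
    naturally_isomorphic (comp_functor G F) (id_functor C) /\
    naturally_isomorphic (comp_functor F G) (id_functor D).

End Functors.

Section ProductCategory.
Variables C D : category.

Let pobj := (C * D)%type.
Let phom (a b : pobj) := (hom a.1 b.1 * hom a.2 b.2)%type.
Let pid (a : pobj) : phom a a := (idm a.1, idm a.2).
Let pcomp (a b c : pobj) (g : phom b c) (f : phom a b) : phom a c :=
  (comp g.1 f.1, comp g.2 f.2).

Lemma prod_category_assoc a b c d (h : phom c d) (g : phom b c) (f : phom a b) :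
  pcomp h (pcomp g f) = pcomp (pcomp h g) f.
Proof. by rewrite /pcomp /= !comp_assoc. Qed.

Lemma prod_category_idl a b (f : phom a b) : pcomp (pid b) f = f.
Proof. by case: f => f1 f2; rewrite /pcomp /= !comp_idl. Qed.

Lemma prod_category_idr a b (f : phom a b) : pcomp f (pid a) = f.
Proof. by case: f => f1 f2; rewrite /pcomp /= !comp_idr. Qed.

Definition prod_category : category :=
  Category prod_category_assoc prod_category_idl prod_category_idr.

End ProductCategory.

Section Coslice.
Variables (C : category) (X : C).

Record under := Under { under_obj : C; under_arr : hom X under_obj }.

Definition under_hom (a b : under) : Type :=
  {h : hom (under_obj a) (under_obj b) | comp h (under_arr a) = under_arr b}.

Lemma under_hom_eq a b (f g : under_hom a b) : sval f = sval g -> f = g.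
Proof. exact: eq_sig_hprop (fun _ => @Prop_irrelevance _) f g. Qed.

Definition under_id (a : under) : under_hom a a :=
  exist _ (idm (under_obj a)) (comp_idl (under_arr a)).

Lemma under_compP a b c (g : under_hom b c) (f : under_hom a b) :
  comp (comp (sval g) (sval f)) (under_arr a) = under_arr c.
Proof. by rewrite -comp_assoc (svalP f) (svalP g). Qed.

Definition under_comp a b c (g : under_hom b c) (f : under_hom a b) :
  under_hom a c := exist _ (comp (sval g) (sval f)) (under_compP g f).

Lemma under_assoc a b c d
    (h : under_hom c d) (g : under_hom b c) (f : under_hom a b) :
  under_comp h (under_comp g f) = under_comp (under_comp h g) f.
Proof. exact/under_hom_eq/comp_assoc. Qed.

Lemma under_idl a b (f : under_hom a b) : under_comp (under_id b) f = f.
Proof. exact/under_hom_eq/comp_idl. Qed.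

Lemma under_idr a b (f : under_hom a b) : under_comp f (under_id a) = f.
Proof. exact/under_hom_eq/comp_idr. Qed.

Definition coslice : category := Category under_assoc under_idl under_idr.

End Coslice.

(* Products are chosen; a different choice changes times_functor only by an
   isomorphism. *)
Record finite_products (C : category) := FiniteProducts {
  terminal_obj : C;
  to_terminal : forall a : C, hom a terminal_obj;
  to_terminal_unique : forall (a : C) (f g : hom a terminal_obj), f = g;
  product : C -> C -> C;
  pr1 : forall x y, hom (product x y) x;
  pr2 : forall x y, hom (product x y) y;
  pairing : forall a x y, hom a x -> hom a y -> hom a (product x y);
  pr1_pairing : forall a x y (f : hom a x) (g : hom a y),
    comp (pr1 x y) (pairing f g) = f;
  pr2_pairing : forall a x y (f : hom a x) (g : hom a y),
    comp (pr2 x y) (pairing f g) = g;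
  pairing_unique : forall a x y (f g : hom a (product x y)),
    comp (pr1 x y) f = comp (pr1 x y) g ->
    comp (pr2 x y) f = comp (pr2 x y) g -> f = g }.

Section Coextensive.
Variables (C : category) (P : finite_products C).

Definition product_mor a b x y (f : hom a x) (g : hom b y) :
  hom (product P a b) (product P x y) :=
  pairing P (comp f (pr1 P a b)) (comp g (pr2 P a b)).

Lemma product_mor_id a b :
  product_mor (idm a) (idm b) = idm (product P a b).
Proof.
by apply: (pairing_unique (f := product_mor _ _));
  rewrite ?pr1_pairing ?pr2_pairing comp_idl comp_idr.
Qed.

Lemma product_mor_comp a a' a'' b b' b''
    (f' : hom a' a'') (f : hom a a') (g' : hom b' b'') (g : hom b b') :
  product_mor (comp f' f) (comp g' g) =
  comp (product_mor f' g') (product_mor f g).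
Proof.
rewrite /product_mor; apply: (pairing_unique (f := pairing P _ _)).
- rewrite pr1_pairing [RHS]comp_assoc pr1_pairing -[RHS]comp_assoc pr1_pairing.
  by rewrite comp_assoc.
- rewrite pr2_pairing [RHS]comp_assoc pr2_pairing -[RHS]comp_assoc pr2_pairing.
  by rewrite comp_assoc.
Qed.

Variables X Y : C.
Let XY := prod_category (coslice X) (coslice Y).

Definition times_obj (a : XY) : coslice (product P X Y) :=
  Under (product_mor (under_arr a.1) (under_arr a.2)).

Lemma times_morP (a b : XY) (h : hom a b) :
  comp (product_mor (sval h.1) (sval h.2)) (under_arr (times_obj a)) =
  under_arr (times_obj b).
Proof. by rewrite /= -product_mor_comp (svalP h.1) (svalP h.2). Qed.

Definition times_mor (a b : XY) (h : hom a b) :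
  hom (times_obj a) (times_obj b) :=
  exist _ (product_mor (sval h.1) (sval h.2)) (times_morP h).

Lemma times_mor_id a : times_mor (idm a) = idm (times_obj a).
Proof. exact/under_hom_eq/product_mor_id. Qed.

Lemma times_mor_comp a b c (g : hom b c) (f : hom a b) :
  times_mor (comp g f) = comp (times_mor g) (times_mor f).
Proof. exact/under_hom_eq/product_mor_comp. Qed.

Definition times_functor : functor XY (coslice (product P X Y)) :=
  Functor times_mor_id times_mor_comp.

End Coextensive.

Definition coextensive (C : category) (P : finite_products C) : Prop :=
  forall X Y : C, is_equivalence (times_functor P X Y).

Section VarietyCategory.
Variables (Sg : signature) (V : variety Sg).

Record variety_obj := VarietyObj {
  variety_alg :> algebra Sg;
  variety_objP : V variety_alg }.

Lemma variety_comp_assoc (a b c d : variety_obj)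
    (h : homomorphism c d) (g : homomorphism b c) (f : homomorphism a b) :
  comp_hom h (comp_hom g f) = comp_hom (comp_hom h g) f.
Proof. exact: homomorphism_eq. Qed.

Lemma variety_comp_idl (a b : variety_obj) (f : homomorphism a b) :
  comp_hom (id_hom b) f = f.
Proof. exact: homomorphism_eq. Qed.

Lemma variety_comp_idr (a b : variety_obj) (f : homomorphism a b) :
  comp_hom f (id_hom a) = f.
Proof. exact: homomorphism_eq. Qed.

Definition variety_category : category :=
  @Category variety_obj (fun A B => homomorphism A B) (fun A => id_hom A)
    (fun _ _ _ g f => comp_hom g f)
    variety_comp_assoc variety_comp_idl variety_comp_idr.

Lemma trivial_in_variety : V (trivial_algebra Sg).
Proof.
case: V => W [E /= hE]; apply/hE => s t _ e.
by case: (eval e s) (eval e t) => -[].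
Qed.

Lemma eval_prod (A B : algebra Sg) X (e : X -> prod_algebra A B) t :
  eval e t = (eval (fun x => (e x).1) t, eval (fun x => (e x).2) t).
Proof.
elim: t => [x|s args IH] /=; first by case: (e x).
by congr (op s _, op s _); apply: funext => i; rewrite IH.
Qed.

Lemma prod_in_variety (A B : algebra Sg) : V A -> V B -> V (prod_algebra A B).
Proof.
case: V => W [E /= hE] /hE hA /hE hB; apply/hE => s t st e.
by rewrite !eval_prod (hA s t st) (hB s t st).
Qed.

Definition variety_terminal : variety_category := VarietyObj trivial_in_variety.

Definition variety_product (A B : variety_category) : variety_category :=
  VarietyObj (prod_in_variety (variety_objP A) (variety_objP B)).

Lemma to_trivial_is_hom (A : algebra Sg) :
  is_hom (A := A) (B := trivial_algebra Sg) (fun=> tt).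
Proof. by []. Qed.

Lemma fst_is_hom (A B : algebra Sg) :
  is_hom (A := prod_algebra A B) (B := A) fst.
Proof. by []. Qed.

Lemma snd_is_hom (A B : algebra Sg) :
  is_hom (A := prod_algebra A B) (B := B) snd.
Proof. by []. Qed.

Lemma pair_is_hom (A B C : algebra Sg)
    (f : homomorphism C A) (g : homomorphism C B) :
  is_hom (A := C) (B := prod_algebra A B) (fun x => (f x, g x)).
Proof. by move=> s a; rewrite !hom_funP. Qed.

Definition variety_pr1 (A B : variety_category) : hom (variety_product A B) A :=
  Homomorphism (@fst_is_hom A B).

Definition variety_pr2 (A B : variety_category) : hom (variety_product A B) B :=
  Homomorphism (@snd_is_hom A B).

Definition variety_pairing (C A B : variety_category)
    (f : hom C A) (g : hom C B) : hom C (variety_product A B) :=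
  Homomorphism (pair_is_hom f g).

Lemma variety_to_terminal_unique (A : variety_category)
  (f g : hom A variety_terminal) : f = g.
Proof. by apply: homomorphism_eq => x; case: (f x) (g x) => -[]. Qed.

Lemma variety_pr1_pairing (C A B : variety_category)
    (f : hom C A) (g : hom C B) :
  comp (variety_pr1 A B) (variety_pairing f g) = f.
Proof. exact: homomorphism_eq. Qed.

Lemma variety_pr2_pairing (C A B : variety_category)
    (f : hom C A) (g : hom C B) :
  comp (variety_pr2 A B) (variety_pairing f g) = g.
Proof. exact: homomorphism_eq. Qed.

Lemma variety_pairing_unique (C A B : variety_category)
    (f g : hom C (variety_product A B)) :
  comp (variety_pr1 A B) f = comp (variety_pr1 A B) g ->
  comp (variety_pr2 A B) f = comp (variety_pr2 A B) g -> f = g.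
Proof.
move=> e1 e2; apply: homomorphism_eq => x.
have := congr1 (fun h : homomorphism C A => h x) e1.
have := congr1 (fun h : homomorphism C B => h x) e2.
by rewrite /=; case: (hom_fun f x) (hom_fun g x) => [a b] [c d] /= -> ->.
Qed.

Definition variety_products : finite_products variety_category :=
  @FiniteProducts variety_category variety_terminal
    (fun A : variety_obj => Homomorphism (@to_trivial_is_hom A)) variety_to_terminal_unique
    variety_product variety_pr1 variety_pr2 variety_pairing
    variety_pr1_pairing variety_pr2_pairing variety_pairing_unique.

Definition coextensive_variety : Prop := coextensive variety_products.

End VarietyCategory.

(* Main.v *)
(* Pierce => coextensive.  Let f : X * Y -> A, and let e, e' be the images under
   f of the tuples of pairs (0_i, 1_i) and (1_i, 0_i).  In a subdirectly
   irreducible quotient S of A the image of X * Y is directly indecomposable,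
   and U(-,-,e,e') splits it, so (e, e') becomes (0, 1) or (1, 0) in S.  Hence
   d(x, y) = U(x, y, e, e') is one of the two projections in every such S;
   since these quotients separate points, d satisfies on A the equations of the
   case distinction of a direct product, and f becomes a product of two
   homomorphisms along the resulting decomposition of A.

   Coextensive => Pierce.  Let F be free on x, y, and let S <= F * F be
   generated by (x, x), (y, y) and all pairs of closed terms.  With K the closed
   elements of F, coextensivity decomposes K * K -> S as a product, and makes the
   inclusion S -> F * F a product of two homomorphisms along it, which forces
   (x, y) into S; a term witnessing this is U. *)
From mathcomp Require Import all_boot.
From mathcomp Require Import boolp classical_sets.
Require Import Defs.

Set Implicit Arguments.
Unset Strict Implicit.
Unset Printing Implicit Defensive.

(** * Homomorphisms, images and closure properties of varieties *)

Section Homomorphisms.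
Variable Sg : signature.
Implicit Types (A B C : algebra Sg) (V : variety Sg).

Lemma bijective_is_isomorphism A B (f : homomorphism A B) :
  injective f -> (forall b, exists a, f a = b) -> is_isomorphism f.
Proof.
move=> f_inj f_surj; have [g gK] := choice f_surj.
have g_hom : is_hom g.
  move=> s a; apply: f_inj; rewrite hom_funP gK; congr (op s _).
  by apply: funext => i; rewrite gK.
exists (Homomorphism g_hom); split=> [a|b]; last exact: gK.
by apply: f_inj; rewrite gK.
Qed.

Lemma hom_eval A B (f : homomorphism A B) X (e : X -> A) t :
  f (eval e t) = eval (f \o e) t.
Proof.
elim: t => [//|s args IH] /=; rewrite hom_funP; congr (op s _).
by apply: funext => i; rewrite IH.
Qed.

Lemma eval_subst A X Y (sigma : X -> term Sg Y) (e : Y -> A) t :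
  eval e (subst sigma t) = eval (fun x => eval e (sigma x)) t.
Proof.
elim: t => [//|s args IH] /=; congr (op s _).
by apply: funext => i; rewrite IH.
Qed.

Lemma eval_closed_in A X (e : X -> A) (t : closed_term Sg) :
  eval e (closed_in X t) = eval (of_void A) t.
Proof. by rewrite eval_subst; congr (eval _ t); apply: funext => -[]. Qed.

Lemma hom_eval_closed A B (f : homomorphism A B) (t : closed_term Sg) :
  f (eval (of_void A) t) = eval (of_void B) t.
Proof. by rewrite hom_eval; congr (eval _ t); apply: funext => -[]. Qed.

Lemma surjective_in_variety V A B (f : homomorphism A B) :
  (forall b, exists a, f a = b) -> V A -> V B.
Proof.
case: V => W [E /= hE] f_surj /hE hA; apply/hE => s t st e.
have [g gK] := choice f_surj.
have -> : e = f \o (g \o e) by apply: funext => n /=; rewrite gK.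
by rewrite -!hom_eval (hA s t st).
Qed.

Lemma injective_in_variety V A B (f : homomorphism A B) :
  injective f -> V B -> V A.
Proof.
case: V => W [E /= hE] f_inj /hE hB; apply/hE => s t st e.
by apply: f_inj; rewrite !hom_eval (hB s t st).
Qed.

Lemma sval_is_hom A (P : subuniverse A) : is_hom (A := subalgebra P) sval.
Proof. by []. Qed.

Definition subalgebra_incl A (P : subuniverse A) :
  homomorphism (subalgebra P) A := Homomorphism (@sval_is_hom A P).

Lemma sval_inj A (P : subuniverse A) : injective (subalgebra_incl P).
Proof. exact: eq_sig_hprop (fun _ => @Prop_irrelevance _). Qed.

Lemma range_closed A B (f : homomorphism A B) (s : symb Sg)
    (b : 'I_(arity s) -> B) :
  (forall i, exists a, f a = b i) -> exists a, f a = op s b.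
Proof.
move=> /choice[a fa]; exists (op s a); rewrite hom_funP; congr (op s _).
exact: funext.
Qed.

Definition range_sub A B (f : homomorphism A B) : subuniverse B :=
  @Subuniverse Sg B (fun b => exists a, f a = b) (range_closed (f := f)).

Definition range_corestr A B (f : homomorphism A B) (a : A) :
  subalgebra (range_sub f) := exist (range_sub f) (f a) (ex_intro _ a erefl).

Lemma range_corestr_is_hom A B (f : homomorphism A B) :
  is_hom (range_corestr f).
Proof. by move=> s a; apply: sval_inj; rewrite /= hom_funP. Qed.

Definition range_hom A B (f : homomorphism A B) :
  homomorphism A (subalgebra (range_sub f)) :=
  Homomorphism (range_corestr_is_hom f).

Lemma range_hom_surj A B (f : homomorphism A B) b : exists a, range_hom f a = b.
Proof. by case: b => b [a fab]; exists a; apply: sval_inj. Qed.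

End Homomorphisms.

(** * Congruences and quotient algebras *)

Record congruence (Sg : signature) (A : algebra Sg) := Congruence {
  cong_rel :> A -> A -> Prop;
  cong_refl : forall x, cong_rel x x;
  cong_sym : forall x y, cong_rel x y -> cong_rel y x;
  cong_trans : forall x y z, cong_rel x y -> cong_rel y z -> cong_rel x z;
  cong_op : forall (s : symb Sg) (a b : 'I_(arity s) -> A),
    (forall i, cong_rel (a i) (b i)) -> cong_rel (op s a) (op s b) }.

Section Quotients.
Variables (Sg : signature) (A : algebra Sg) (theta : congruence A).

(** Classes are predicates, so that related elements have equal classes by extensionality. *)
Definition quotient_carrier := {P : A -> Prop | exists a, P = theta a}.

Definition class_of (a : A) : quotient_carrier :=
  exist _ (theta a) (ex_intro _ a erefl).

Definition repr_of (p : quotient_carrier) : A := sval (cid (svalP p)).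

Lemma class_ofP a b : class_of a = class_of b <-> theta a b.
Proof.
split=> [/(congr1 sval) /= ->|ab]; first exact: cong_refl.
apply: eq_sig_hprop => [?|/=]; first exact: Prop_irrelevance.
apply: funext => c; apply: propext; split; apply: cong_trans => //.
exact: cong_sym.
Qed.

Lemma repr_ofK p : class_of (repr_of p) = p.
Proof.
case: p => P hP; apply: eq_sig_hprop => [?|/=]; first exact: Prop_irrelevance.
by rewrite /repr_of /=; case: cid.
Qed.

Definition quotient : algebra Sg :=
  @Algebra Sg quotient_carrier
    (fun s p => class_of (op s (fun i => repr_of (p i)))).

Lemma class_of_is_hom : is_hom (B := quotient) class_of.
Proof.
move=> s a; apply/class_ofP; apply: cong_op => i; apply/class_ofP.
by rewrite repr_ofK.
Qed.

Definition quotient_hom : homomorphism A quotient :=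
  Homomorphism class_of_is_hom.

Lemma quotient_hom_surj p : exists a, quotient_hom a = p.
Proof. by exists (repr_of p); apply: repr_ofK. Qed.

End Quotients.

Lemma kernel_op (Sg : signature) (A B : algebra Sg) (f : homomorphism A B)
    (s : symb Sg) (a b : 'I_(arity s) -> A) :
  (forall i, f (a i) = f (b i)) -> f (op s a) = f (op s b).
Proof. by move=> fab; rewrite !hom_funP; congr (op s _); apply: funext. Qed.

Definition kernel (Sg : signature) (A B : algebra Sg) (f : homomorphism A B) :
  congruence A :=
  @Congruence Sg A (fun x y => f x = f y) (fun=> erefl) (fun _ _ => @esym _ _ _)
    (fun _ _ _ => @etrans _ _ _ _) (kernel_op (f := f)).

(** * Birkhoff's subdirect representation *)

Section SubdirectRepresentation.
Variables (Sg : signature) (A : algebra Sg).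

(** Finitely many members of a chain have a largest one. As arities are finite, this makes the union
    of a nonempty chain of congruences a congruence. *)
Lemma chain_common_bound (F : set (set (A * A))) n
    (a b : 'I_n -> A) (R0 : set (A * A)) :
  F R0 -> total_on F subset ->
  (forall i, exists2 R, F R & a i = b i \/ R (a i, b i)) ->
  exists2 R, F R & forall i, a i = b i \/ R (a i, b i).
Proof.
move=> FR0 chF ab.
suff [R FR Rab] : exists2 R, F R &
    forall i, i \in enum 'I_n -> a i = b i \/ R (a i, b i).
  by exists R => // i; apply: Rab; rewrite mem_enum.
elim: (enum 'I_n) => [|i s [R FR Rab]]; first by exists R0.
have [R' FR' R'ab] := ab i.
have [sub|sub] := chF _ _ FR FR'.
- exists R' => // j; rewrite inE => /predU1P[->//|/Rab[|/sub]]; by [left|right].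
- exists R => // j; rewrite inE => /predU1P[->|/Rab//].
  by case: R'ab => [|/sub]; [left|right].
Qed.

(** Zorn's lemma, applied to the sets of pairs that omit [(x, y)] and become a congruence when the
    diagonal is added. *)
Lemma maximal_separating_congruence (x y : A) : x <> y ->
  exists theta : congruence A, ~ theta x y /\
    forall theta' : congruence A, (forall a b, theta a b -> theta' a b) ->
      ~ theta' x y -> forall a b, theta' a b -> theta a b.
Proof.
move=> xy.
(* Relations are represented without their diagonal part, so that the union of
   the empty chain is admissible. *)
pose refl_cl (R : set (A * A)) a b := a = b \/ R (a, b).
pose P (R : set (A * A)) := ~ R (x, y) /\
  exists theta : congruence A, forall a b, theta a b <-> refl_cl R a b.
have [F FP chF|R [[Rxy [theta thetaR]] Rmax]] := @Zorn_bigcup _ P.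
  split; first by case=> R FR Rxy; case: (FP _ FR).
  have FE R : F R -> exists theta : congruence A,
      forall a b, theta a b <-> refl_cl R a b by move=> /FP[].
  have [[R0 FR0]|F0] := pselect (exists R0, F R0); last first.
    have F0' a b : ~ (\bigcup_(R in F) R)%classic (a, b).
      by case=> R FR _; apply: F0; exists R.
    exists (kernel (id_hom A)) => a b; split=> [->|[//|/F0'//]]; by left.
  pose Q := refl_cl (\bigcup_(R in F) R)%classic.
  (* Each law of a congruence involves finitely many related pairs, hence is inherited from a single
     member of the chain. *)
  have QE n (a b : 'I_n -> A) : (forall i, Q (a i) (b i)) ->
      exists2 R, F R & forall i, refl_cl R (a i) (b i).
    move=> Qab; apply: (chain_common_bound FR0 chF) => i.
    by case: (Qab i) => [->|[R FR Rab]]; [exists R0; [|left]|exists R; [|right]].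
  have QI R a b : F R -> refl_cl R a b -> Q a b.
    by move=> FR [->|Rab]; [left|right; exists R].
  have Qrefl a : Q a a by left.
  have Qsym a b : Q a b -> Q b a.
    move=> Qab; have [//|R FR /(_ ord0) Rab] := QE 1 (fun=> a) (fun=> b).
    have [th thR] := FE _ FR.
    by apply: (QI R) => //; apply/thR/cong_sym/thR.
  have Qtrans a b c : Q a b -> Q b c -> Q a c.
    move=> Qab Qbc.
    have [|R FR Rabc] := QE 2 (fun i => if i == ord0 then a else b)
                              (fun i => if i == ord0 then b else c).
      by move=> i; case: ifP.
    have [th thR] := FE _ FR.
    apply: (QI R) => //; apply/thR/(@cong_trans _ _ th _ b); apply/thR.
    - exact: (Rabc ord0).
    - exact: (Rabc (lift ord0 ord0)).
  have Qop s (a b : 'I_(arity s) -> A) :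
      (forall i, Q (a i) (b i)) -> Q (op s a) (op s b).
    move=> /QE[R FR Rab]; have [th thR] := FE _ FR.
    by apply: (QI R) => //; apply/thR/cong_op => i; apply/thR.
  by exists (Congruence Qrefl Qsym Qtrans Qop).
exists theta; split; first by move=> /thetaR[].
move=> theta' sub theta'xy a b theta'ab; apply/thetaR.
(* If [theta'] related a pair outside [R], it would be a strictly larger admissible set. *)
pose R' : set (A * A) := fun p => theta' p.1 p.2.
have PR' : P R'.
  split=> //; exists theta' => u v; split; first by right.
  by case=> [->|//]; apply: cong_refl.
right; apply: contrapT => Rab; apply: (Rmax R') => //; split.
  by move=> [u v] Ruv; apply: sub; apply/thetaR; right.
by move=> /(_ (a, b) theta'ab).
Qed.

(** Congruences properly above a maximal separating [theta] identify [x] and [y]. Some coordinate of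
    a subdirect embedding of the quotient keeps their classes apart, so its kernel pulls back to
    [theta] and this coordinate is an isomorphism. *)
Lemma separating_subdirectly_irreducible (x y : A) : x <> y ->
  exists (S : algebra Sg) (q : homomorphism A S),
    [/\ subdirectly_irreducible S, forall b, exists a, q a = b & q x <> q y].
Proof.
move=> /maximal_separating_congruence[theta [thxy thmax]].
exists (quotient theta), (quotient_hom theta).
have surj := @quotient_hom_surj _ _ theta.
split=> [I B f [f_inj f_surj]|//|/class_ofP//].
have [i fxy] : exists i, f (class_of theta x) i <> f (class_of theta y) i.
  apply/existsNP => fxy; apply/thxy/class_ofP/f_inj.
  exact: functional_extensionality_dep.
exists i; apply: bijective_is_isomorphism => [p q|]; last exact: f_surj.
have [[a <-] [b <-]] := (surj p, surj q) => /= fpq; apply/class_ofP.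
pose g := comp_hom (comp_hom (proj_hom B i) f) (quotient_hom theta).
by apply: (thmax (kernel g)) => // u v /class_ofP /= ->.
Qed.

End SubdirectRepresentation.

(* A decomposition operation: the case distinction [d x y = (x.1, y.2)] of a
   direct product, axiomatised. *)
Record decomposition (Sg : signature) (A : algebra Sg) := Decomposition {
  dec :> A -> A -> A;
  dec_op : forall (s : symb Sg) (a b : 'I_(arity s) -> A),
    dec (op s a) (op s b) = op s (fun i => dec (a i) (b i));
  dec_diag : forall x, dec x x = x;
  dec_decl : forall x y z, dec (dec x y) z = dec x z;
  dec_decr : forall x y z, dec x (dec y z) = dec x z }.

(** * Factor congruences of a decomposition operation *)

Section Decomposition.
Variables (Sg : signature) (A : algebra Sg) (d : decomposition A).

Lemma factor1_sym x y : d x y = y -> d y x = x.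
Proof. by move=> <-; rewrite dec_decl dec_diag. Qed.

Lemma factor1_trans x y z : d x y = y -> d y z = z -> d x z = z.
Proof. by move=> <-; rewrite dec_decl. Qed.

Lemma factor1_op s (a b : 'I_(arity s) -> A) :
  (forall i, d (a i) (b i) = b i) -> d (op s a) (op s b) = op s b.
Proof. by move=> dab; rewrite dec_op; congr (op s _); apply: funext. Qed.

(** When [d x y] is [(x.1, y.2)], the equation [d x y = y] says that the first components agree; in
    [factor2], [d x y = x] says this of the second ones. *)
Definition factor1 : congruence A :=
  @Congruence Sg A (fun x y => d x y = y) (dec_diag d) factor1_sym factor1_trans
    factor1_op.

Lemma factor2_sym x y : d x y = x -> d y x = y.
Proof. by move=> <-; rewrite dec_decr dec_diag. Qed.

Lemma factor2_trans x y z : d x y = x -> d y z = y -> d x z = x.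
Proof. by move=> + yz; rewrite -yz dec_decr. Qed.

Lemma factor2_op s (a b : 'I_(arity s) -> A) :
  (forall i, d (a i) (b i) = a i) -> d (op s a) (op s b) = op s a.
Proof. by move=> dab; rewrite dec_op; congr (op s _); apply: funext. Qed.

Definition factor2 : congruence A :=
  @Congruence Sg A (fun x y => d x y = x) (dec_diag d) factor2_sym factor2_trans
    factor2_op.

Definition factor_hom : homomorphism A
    (prod_algebra (quotient factor1) (quotient factor2)) :=
  Homomorphism (pair_is_hom (quotient_hom factor1) (quotient_hom factor2)).

(** Elements congruent for both factors satisfy [x = d x y = y], and the pair of classes of [x] and
    [y] is the image of [d x y]. *)
Lemma factor_hom_iso : is_isomorphism factor_hom.
Proof.
apply: bijective_is_isomorphism => [x y xy|[p q]].
  have /class_ofP /= <- := congr1 fst xy.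
  by have /class_ofP /= -> := congr1 snd xy.
have [[x <-] [y <-]] := (quotient_hom_surj p, quotient_hom_surj q).
exists (d x y); congr pair; apply/class_ofP => /=.
- by rewrite dec_decl dec_diag.
- by rewrite dec_decl.
Qed.

(** A factor congruence that is not total has a nontrivial quotient, and indecomposability forbids
    two of these. *)
Lemma decomposition_of_indecomposable : directly_indecomposable A ->
  (forall x y, d x y = y) \/ (forall x y, d x y = x).
Proof.
move=> diA; apply: contrapT => /not_orP[/existsNP[x /existsNP[y dy]]].
move=> /existsNP[u /existsNP[v du]]; apply: diA.
exists (quotient factor1), (quotient factor2); split.
- by exists (class_of factor1 x), (class_of factor1 y) => /class_ofP.
- by exists (class_of factor2 u), (class_of factor2 v) => /class_ofP.
- by exists factor_hom; apply: factor_hom_iso.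
Qed.

End Decomposition.

(** * Decompositions defined by the term [U] *)

Definition U_env N Y (x y : Y) (z w : 'I_N -> Y) (v : U_var N) : Y :=
  match v with Ux => x | Uy => y | Uz i => z i | Uw i => w i end.

Section PierceVariety.
Variables (Sg : signature) (V : variety Sg) (N : nat).
Variables (zero one : 'I_N -> closed_term Sg) (U : term Sg (U_var N)).
Hypothesis U01 : variety_satisfies V
  (subst_U U (Var true) (Var false) (fun i => closed_in bool (zero i))
                                    (fun i => closed_in bool (one i)))
  (Var true).
Hypothesis U10 : variety_satisfies V
  (subst_U U (Var true) (Var false) (fun i => closed_in bool (one i))
                                    (fun i => closed_in bool (zero i)))
  (Var false).
Implicit Types A B X Y S : algebra Sg.

Let cst A (c : 'I_N -> closed_term Sg) i : A := eval (of_void A) (c i).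
Let cases A (x y : A) z w : A := eval (U_env x y z w) U.

Lemma eval_subst_U A (x y : A) c c' :
  eval (fun b : bool => if b then x else y)
    (subst_U U (Var true) (Var false) (fun i => closed_in bool (c i))
                                      (fun i => closed_in bool (c' i)))
  = cases x y (@cst A c) (@cst A c').
Proof.
rewrite eval_subst; congr (eval _ U).
by apply: funext => -[||i|i] //=; rewrite eval_closed_in.
Qed.

Lemma cases01 A (x y : A) : V A -> cases x y (@cst A zero) (@cst A one) = x.
Proof. by move=> VA; rewrite -eval_subst_U (U01 VA). Qed.

Lemma cases10 A (x y : A) : V A -> cases x y (@cst A one) (@cst A zero) = y.
Proof. by move=> VA; rewrite -eval_subst_U (U10 VA). Qed.

Lemma hom_cases A B (f : homomorphism A B) x y z w :
  f (cases x y z w) = cases (f x) (f y) (f \o z) (f \o w).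
Proof.
by rewrite /cases hom_eval; congr (eval _ U); apply: funext => -[||i|i].
Qed.

Let e01 X Y i : prod_algebra X Y := (@cst X zero i, @cst Y one i).
Let e10 X Y i : prod_algebra X Y := (@cst X one i, @cst Y zero i).

(** The parameters read (0, 1) in [X], where [U] returns its first argument, and (1, 0) in [Y],
    where it returns its second. *)
Lemma cases_prod X Y (p q : prod_algebra X Y) : V X -> V Y ->
  cases p q (@e01 X Y) (@e10 X Y) = (p.1, q.2).
Proof.
move=> VX VY; rewrite /cases eval_prod; congr pair.
- rewrite -[RHS](cases01 p.1 q.1 VX); congr (eval _ U).
  by apply: funext => -[].
- rewrite -[RHS](cases10 p.2 q.2 VY); congr (eval _ U).
  by apply: funext => -[].
Qed.

Lemma cases_hom_prod X Y A (f : homomorphism (prod_algebra X Y) A) p q :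
  V X -> V Y -> cases (f p) (f q) (f \o @e01 X Y) (f \o @e10 X Y) = f (p.1, q.2).
Proof. by move=> VX VY; rewrite -hom_cases cases_prod. Qed.

(* A homomorphism of products under [X * Y] is itself a product, because it
   preserves the elements [e01], [e10] which encode the factorisation. *)
Lemma under_prod_hom X Y A B A' B' (u : homomorphism X A) (v : homomorphism Y B)
    (u' : homomorphism X A') (v' : homomorphism Y B')
    (k : homomorphism (prod_algebra A B) (prod_algebra A' B')) p q :
  V A -> V B -> V A' -> V B' -> (forall x y, k (u x, v y) = (u' x, v' y)) ->
  k (p.1, q.2) = ((k p).1, (k q).2).
Proof.
move=> VA VB VA' VB' kuv; rewrite -cases_hom_prod // -(cases_prod (k p)) //.
congr (cases _ _ _ _); apply: funext => i /=; rewrite /e01 /e10 /cst.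
- by rewrite -(hom_eval_closed u) -(hom_eval_closed v) kuv !hom_eval_closed.
- by rewrite -(hom_eval_closed u) -(hom_eval_closed v) kuv !hom_eval_closed.
Qed.

Lemma hom_prod_cst X Y B (f : homomorphism (prod_algebra X Y) B) c i :
  f (@cst X c i, @cst Y c i) = @cst B c i.
Proof.
rewrite /cst -(hom_eval_closed f) eval_prod.
by congr (f (pair _ _)); congr (eval _ _); apply: funext => -[].
Qed.

Section ProductCoslice.
Variables (X Y : algebra Sg) (VX : V X) (VY : V Y).

(** Every element of [B] has the form [f p], so the axioms are inherited from the case distinction
    on [X * Y]. *)
Lemma surjective_decomposition B (f : homomorphism (prod_algebra X Y) B) :
  (forall b, exists a, f a = b) ->
  exists d : decomposition B,
    forall x y, d x y = cases x y (f \o @e01 X Y) (f \o @e10 X Y).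
Proof.
move=> f_surj; pose d x y := cases x y (f \o @e01 X Y) (f \o @e10 X Y).
have df p q : d (f p) (f q) = f (p.1, q.2) by apply: cases_hom_prod.
have dop s (a b : 'I_(arity s) -> B) :
    d (op s a) (op s b) = op s (fun i => d (a i) (b i)).
  have [[g ga] [h hb]] := (choice (fun i => f_surj (a i)),
                           choice (fun i => f_surj (b i))).
  rewrite -(funext ga) -(funext hb) -!hom_funP df.
  have -> : (fun i => d (f (g i)) (f (h i))) = (fun i => f ((g i).1, (h i).2)).
    by apply: funext => i; rewrite df.
  by rewrite -hom_funP.
have dxx x : d x x = x by have [[a b] <-] := f_surj x; rewrite df.
have dl x y z : d (d x y) z = d x z.
  by have [[[a <-] [b <-]] [c <-]] := (f_surj x, f_surj y, f_surj z); rewrite !df.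
have dr x y z : d x (d y z) = d x z.
  by have [[[a <-] [b <-]] [c <-]] := (f_surj x, f_surj y, f_surj z); rewrite !df.
by exists (Decomposition dop dxx dl dr).
Qed.

(* The image of [X * Y] in a subdirectly irreducible algebra is directly
   indecomposable, so one of the two factors is collapsed. *)
Lemma hom_to_S_SI_DI S (f : homomorphism (prod_algebra X Y) S) :
  (forall A, class_S (SI_members V) A -> DI_members V A) -> SI_members V S ->
  (forall x y : S, cases x y (f \o @e01 X Y) (f \o @e10 X Y) = x) \/
  (forall x y : S, cases x y (f \o @e01 X Y) (f \o @e10 X Y) = y).
Proof.
move=> S_SI_DI SI_S; have [VS _] := SI_S.
have [_ diB] := S_SI_DI _ (Class_S (range_sub f) SI_S).
have [d dE] := surjective_decomposition (@range_hom_surj _ _ _ f).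
have dval p q : sval (d (range_hom f p) (range_hom f q)) = f (p.1, q.2).
  by rewrite dE cases_hom_prod.
have [d2|d1] := decomposition_of_indecomposable d diB.
- have fE a a' b : f (a, b) = f (a', b).
    by rewrite -(dval (a, b) (a', b)) d2.
  (* Changing the first coordinate turns the images of [e01] and [e10] into the constant tuples 1
     and 0 of [S]. *)
  right=> x y; rewrite -[RHS](cases10 x y VS); congr (cases _ _ _ _).
  + by apply: funext => i; rewrite /= /e01 (fE _ (@cst X one i)) hom_prod_cst.
  + by apply: funext => i; rewrite /= /e10 (fE _ (@cst X zero i)) hom_prod_cst.
- have fE a b b' : f (a, b) = f (a, b').
    by rewrite -(dval (a, b) (a, b')) d1.
  left=> x y; rewrite -[RHS](cases01 x y VS); congr (cases _ _ _ _).
  + by apply: funext => i; rewrite /= /e01 (fE _ _ (@cst Y zero i)) hom_prod_cst.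
  + by apply: funext => i; rewrite /= /e10 (fE _ _ (@cst Y one i)) hom_prod_cst.
Qed.

(** The axioms of a decomposition hold for both projections, hence for [d] in every subdirectly
    irreducible quotient of [A]. *)
Lemma coslice_decomposition A (f : homomorphism (prod_algebra X Y) A) :
  (forall A, class_S (SI_members V) A -> DI_members V A) -> V A ->
  exists d : decomposition A, forall p q, d (f p) (f q) = f (p.1, q.2).
Proof.
move=> S_SI_DI VA; pose d x y := cases x y (f \o @e01 X Y) (f \o @e10 X Y).
have qd S (q : homomorphism A S) :
    subdirectly_irreducible S -> (forall b, exists a, q a = b) ->
    (forall x y, q (d x y) = q x) \/ (forall x y, q (d x y) = q y).
  move=> SI_S q_surj; have VS := surjective_in_variety q_surj VA.
  have [q1|q2] := hom_to_S_SI_DI (comp_hom q f) S_SI_DI (conj VS SI_S).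
  - by left=> x y; rewrite hom_cases; apply: q1.
  - by right=> x y; rewrite hom_cases; apply: q2.
(* Equations in [A] may be tested under homomorphisms that turn [d] into a projection, since the
   subdirectly irreducible quotients separate points. *)
have sep x y : (forall S (q : homomorphism A S),
    (forall x y, q (d x y) = q x) \/ (forall x y, q (d x y) = q y) ->
    q x = q y) -> x = y.
  move=> qxy; apply: contrapT => /separating_subdirectly_irreducible.
  by move=> [S [q [SI_S q_surj]]]; apply; apply/qxy/qd.
have dop s (a b : 'I_(arity s) -> A) :
    d (op s a) (op s b) = op s (fun i => d (a i) (b i)).
  by apply: sep => S q [qE|qE]; rewrite qE; apply: (kernel_op (f := q)) => i;
    rewrite qE.
have dxx x : d x x = x by apply: sep => S q [qE|qE]; rewrite qE.
have dl x y z : d (d x y) z = d x z.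
  by apply: sep => S q [qE|qE]; rewrite !qE.
have dr x y z : d x (d y z) = d x z.
  by apply: sep => S q [qE|qE]; rewrite !qE.
by exists (Decomposition dop dxx dl dr) => p q; apply: cases_hom_prod.
Qed.

End ProductCoslice.

End PierceVariety.

(** * Equivalences and fully faithful, essentially surjective functors *)

Section Equivalences.
Variables (C D : category) (F : functor C D).

Definition faithful := forall a b (g h : hom a b), fmap F g = fmap F h -> g = h.

Definition full := forall a b (h : hom (F a) (F b)), exists g, fmap F g = h.

Definition essentially_surjective :=
  forall d, exists a (i : hom (F a) d), is_iso i.

Lemma fully_faithful_equivalence :
  faithful -> full -> essentially_surjective -> is_equivalence F.
Proof.
move=> F_faith F_full F_es.
pose G d := projT1 (cid (F_es d)).
pose eps d : hom (F (G d)) d := projT1 (cid (projT2 (cid (F_es d)))).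
have eps_iso d : is_iso (eps d) := projT2 (cid (projT2 (cid (F_es d)))).
pose inv d := projT1 (cid (eps_iso d)).
have invK d : comp (inv d) (eps d) = idm _ := (projT2 (cid (eps_iso d))).1.
have epsK d : comp (eps d) (inv d) = idm _ := (projT2 (cid (eps_iso d))).2.
pose lift a b h := projT1 (cid (F_full a b h)).
have liftK a b h : fmap F (lift a b h) = h := projT2 (cid (F_full a b h)).
(* On arrows, [G] is conjugation by [eps], pulled back along the full functor [F]. *)
pose Gm d d' (h : hom d d') := lift _ _ (comp (inv d') (comp h (eps d))).
have Gid d : Gm _ _ (idm d) = idm (G d).
  by apply: F_faith; rewrite liftK fmap_id comp_idl invK.
have Gcomp a b c (g : hom b c) (f : hom a b) :
    Gm _ _ (comp g f) = comp (Gm _ _ g) (Gm _ _ f).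
  apply: F_faith; rewrite fmap_comp !liftK -!comp_assoc; congr comp.
  by rewrite comp_assoc [comp (eps b) _]comp_assoc epsK comp_idl comp_assoc.
have epsG d d' (h : hom d d') :
    comp (eps d') (fmap F (Gm _ _ h)) = comp h (eps d).
  by rewrite liftK comp_assoc epsK comp_idl.
exists (Functor Gid Gcomp); split; last first.
  by exists eps; split=> // a b f; rewrite -epsG.
(* The isomorphism from [G (F a)] to [a] is the lift of [eps (F a)]. *)
exists (fun a => lift (G (F a)) a (eps (F a))); split=> [a|a b f] /=.
  exists (lift _ _ (inv (F a))).
  by split; apply: F_faith; rewrite fmap_comp !liftK fmap_id.
by apply: F_faith; rewrite !fmap_comp !liftK comp_assoc epsK comp_idl.
Qed.

Lemma equivalence_essentially_surjective :
  is_equivalence F -> essentially_surjective.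
Proof.
move=> [G [_ [eps [eps_iso _]]]] d; exists (G d), (eps d); exact: eps_iso.
Qed.

(** The preimage of [h] is [fmap G h] conjugated by [eta]. Naturality of [eta] shows that its image
    agrees with [h] after [G], which is faithful because [F] after [G] is isomorphic to the
    identity. *)
Lemma equivalence_full : is_equivalence F -> full.
Proof.
move=> [G [[eta [eta_iso eta_nat]] [eps [eps_iso eps_nat]]]] a b h.
have G_faith d d' (g g' : hom d d') : fmap G g = fmap G g' -> g = g'.
  move=> gg'; have [inv [_ epsK]] := eps_iso d.
  have := eps_nat _ _ g; have := eps_nat _ _ g'; rewrite /= gg' => <- ge.
  by rewrite -[g]comp_idr -[g']comp_idr -epsK !comp_assoc ge.
have [inv [invK etaK]] := eta_iso a; have [inv' [inv'K eta'K]] := eta_iso b.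
exists (comp (eta b) (comp (fmap G h) inv)); apply: G_faith.
set g := comp _ _; have /= ge := eta_nat _ _ g.
rewrite -[fmap G (fmap F g)]comp_idl -inv'K -comp_assoc -ge.
by rewrite /g -!comp_assoc invK comp_idr comp_assoc inv'K comp_idl.
Qed.

End Equivalences.

(** * Pierce varieties are coextensive *)

Lemma constant_closed_term (Sg : signature) :
  (exists c : symb Sg, arity c = 0) -> inhabited (closed_term Sg).
Proof. by move=> [c c0]; constructor; apply: (App c) => -[m]; rewrite c0. Qed.

Section DecomposedCoslice.
Variables (Sg : signature) (X Y A : algebra Sg).
Variables (f : homomorphism (prod_algebra X Y) A) (d : decomposition A).
Hypothesis df : forall p q, d (f p) (f q) = f (p.1, q.2).

Lemma factor1_f x y y' :
  quotient_hom (factor1 d) (f (x, y)) = quotient_hom (factor1 d) (f (x, y')).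
Proof. by apply/class_ofP; rewrite /= df. Qed.

Lemma factor2_f x x' y :
  quotient_hom (factor2 d) (f (x, y)) = quotient_hom (factor2 d) (f (x', y)).
Proof. by apply/class_ofP; rewrite /= df. Qed.

(** The point [y0] need not be idempotent, but the class does not depend on it, so it may be
    exchanged for [op s (fun=> y0)]. *)
Lemma factor1_is_hom y0 :
  is_hom (fun x : X => quotient_hom (factor1 d) (f (x, y0))).
Proof.
move=> s a; rewrite (factor1_f _ _ (op s (fun=> y0))).
by rewrite -(hom_funP (comp_hom (quotient_hom (factor1 d)) f) (fun i => (a i, y0))).
Qed.

Lemma factor2_is_hom x0 :
  is_hom (fun y : Y => quotient_hom (factor2 d) (f (x0, y))).
Proof.
move=> s a; rewrite (factor2_f _ (op s (fun=> x0))).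
by rewrite -(hom_funP (comp_hom (quotient_hom (factor2 d)) f) (fun i => (x0, a i))).
Qed.

End DecomposedCoslice.

Lemma variety_hom_app (Sg : signature) (V : variety Sg) (A B : variety_category V)
    (f g : hom A B) : f = g -> hom_fun f =1 hom_fun g.
Proof. by move=> ->. Qed.

Lemma Pierce_coextensive (Sg : signature) (V : variety Sg) :
  (exists c : symb Sg, arity c = 0) ->
  (forall A, class_S (SI_members V) A -> DI_members V A) ->
  Pierce V -> coextensive_variety V.
Proof.
move=> /constant_closed_term[c] S_SI_DI [N [zero [one [U [_ U01 U10]]]]] X Y.
have [VX VY] := (variety_objP X, variety_objP Y).
(* The constant symbol gives every algebra a base point, at which the other factor can be held
   fixed. *)
pose pt (A : algebra Sg) : A := eval (of_void A) c.
apply: fully_faithful_equivalence.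
- move=> [[A u] [B v]] [[A' u'] [B' v']] [g1 g2] [h1 h2].
  move=> g_eq_h; have gh := variety_hom_app (congr1 sval g_eq_h); congr pair.
  + by apply/under_hom_eq/homomorphism_eq => a; case: (gh (a, pt B)).
  + by apply/under_hom_eq/homomorphism_eq => b; case: (gh (pt A, b)).
- move=> [[A u] [B v]] [[A' u'] [B' v']] [k k_under].
  have kuv x y : hom_fun k (hom_fun u x, hom_fun v y)
      = (hom_fun u' x, hom_fun v' y) := variety_hom_app k_under (x, y).
  (* Fullness: each component of [k] depends on one argument only, so [k] splits into two
     homomorphisms. *)
  have kE p q := under_prod_hom U01 U10 p q (variety_objP A) (variety_objP B)
    (variety_objP A') (variety_objP B') kuv.
  have k1 a b b' : (hom_fun k (a, b)).1 = (hom_fun k (a, b')).1.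
    by rewrite (kE (a, b') (a, b)).
  have k2 a a' b : (hom_fun k (a, b)).2 = (hom_fun k (a', b)).2.
    by rewrite (kE (a, b) (a', b)).
  have h1P : is_hom (fun a : A => (hom_fun k (a, pt B)).1).
    move=> s a; rewrite (k1 _ _ (op s (fun=> pt B))).
    by rewrite (hom_funP k (fun i => (a i, pt B))).
  have h2P : is_hom (fun b : B => (hom_fun k (pt A, b)).2).
    move=> s b; rewrite (k2 _ (op s (fun=> pt A))).
    by rewrite (hom_funP k (fun i => (pt A, b i))).
  have h1u : comp (Homomorphism h1P : hom A A') u = u'.
    by apply: homomorphism_eq => x; rewrite /= (k1 _ _ (hom_fun v (pt Y))) kuv.
  have h2v : comp (Homomorphism h2P : hom B B') v = v'.
    by apply: homomorphism_eq => y; rewrite /= (k2 _ (hom_fun u (pt X))) kuv.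
  exists (exist (fun h : hom A A' => comp h u = u') _ h1u,
          exist (fun h : hom B B' => comp h v = v') _ h2v).
  apply/under_hom_eq/homomorphism_eq => -[a b] /=.
  by rewrite (kE (a, pt B) (pt A, b)).
(* Essential surjectivity: the two factors of [A] along [f] receive homomorphisms from [X] and
   [Y]. *)
- move=> [A f]; have VA := variety_objP A.
  have [d df] := coslice_decomposition U01 U10 VX VY f S_SI_DI VA.
  have [g [gK Kg]] := factor_hom_iso d.
  pose A1 := VarietyObj (surjective_in_variety (@quotient_hom_surj _ _ (factor1 d)) VA).
  pose A2 := VarietyObj (surjective_in_variety (@quotient_hom_surj _ _ (factor2 d)) VA).
  pose u1 : homomorphism X A1 := Homomorphism (factor1_is_hom df (pt Y)).
  pose u2 : homomorphism Y A2 := Homomorphism (factor2_is_hom df (pt X)).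
  pose a12 := (@Under (variety_category V) X A1 u1,
               @Under (variety_category V) Y A2 u2).
  have fE p : factor_hom d (f p) = (u1 p.1, u2 p.2).
    by case: p => x y; congr pair; [apply: factor1_f|apply: factor2_f].
  pose F := times_functor (variety_products V) X Y.
  have gP : comp (g : hom (under_obj (F a12)) A) (under_arr (F a12)) = f.
    by apply: homomorphism_eq => p; rewrite -[RHS]gK fE.
  have hP : comp (factor_hom d : hom A (under_obj (F a12))) f
      = under_arr (F a12).
    by apply: homomorphism_eq => p; apply: fE.
  exists a12, (exist (fun h => comp h _ = _) _ gP).
  exists (exist (fun h => comp h _ = _) _ hP).
  by split; apply/under_hom_eq/homomorphism_eq.
Qed.

(** * Term algebras and free algebras *)

Section FreeAlgebras.
Variables (Sg : signature) (V : variety Sg).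

Definition term_algebra (X : Type) : algebra Sg :=
  @Algebra Sg (term Sg X) (fun s args => App s args).

Lemma eval_is_hom (A : algebra Sg) X (e : X -> A) :
  is_hom (A := term_algebra X) (eval e).
Proof. by []. Qed.

Definition eval_hom (A : algebra Sg) X (e : X -> A) :
  homomorphism (term_algebra X) A := Homomorphism (eval_is_hom e).

Lemma eval_term_algebra X Y (sigma : X -> term Sg Y) t :
  eval (A := term_algebra Y) sigma t = subst sigma t.
Proof.
by elim: t => [//|s args IH] /=; congr (App s _); apply: funext => i; rewrite IH.
Qed.

Lemma subst_subst X Y Z (tau : Y -> term Sg Z) (sigma : X -> term Sg Y) t :
  subst tau (subst sigma t) = subst (fun x => subst tau (sigma x)) t.
Proof.
rewrite -[LHS]eval_term_algebra eval_subst -[RHS]eval_term_algebra.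
by congr (@eval _ (term_algebra Z) _ _ t); apply: funext => x;
  rewrite eval_term_algebra.
Qed.

Lemma identities_op X s (a b : 'I_(arity s) -> term_algebra X) :
  (forall i, variety_satisfies V (a i) (b i)) ->
  variety_satisfies V (op s a) (op s b).
Proof.
move=> ab A VA e /=; congr (op s _); apply: funext => i; exact: ab.
Qed.

Definition identities X : congruence (term_algebra X) :=
  @Congruence Sg (term_algebra X) (@variety_satisfies Sg V X)
    (fun _ _ _ _ => erefl) (fun _ _ st A VA e => esym (st A VA e))
    (fun _ _ _ st tu A VA e => etrans (st A VA e) (tu A VA e))
    (@identities_op X).

Definition free_algebra X : algebra Sg := quotient (identities X).

Lemma eval_free X Y (sigma : X -> term Sg Y) t :
  eval (A := free_algebra Y) (fun x => class_of (identities Y) (sigma x)) t =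
  class_of (identities Y) (subst sigma t).
Proof. by rewrite -eval_term_algebra -(hom_eval (quotient_hom _)). Qed.

(** Assignments into the free algebra are substitutions, and substitution instances of the defining
    identities hold throughout [V]. *)
Lemma free_in_variety X : V (free_algebra X).
Proof.
case: (variety_equational V) => E VE; apply/VE => s t st e.
have -> : e = (fun n => class_of (identities X) (repr_of (e n))).
  by apply: funext => n; rewrite repr_ofK.
rewrite !eval_free; apply/class_ofP => A /VE hA e'.
by rewrite !eval_subst (hA s t st).
Qed.

(** Finite arities keep the disjoint union of the supports of the arguments finite. This supplies
    the finite number of parameters of [U]. *)
Lemma term_finite_support X (t : term Sg X) :
  exists (J : finType) (f : J -> X) (U : term Sg J),
    t = subst (fun j => Var (f j)) U.
Proof.
elim: t => [x|s args IH].
  by exists unit, (fun=> x), (Var tt).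
pose J i := projT1 (cid (IH i)).
have IH1 i : exists (f : J i -> X) (U : term Sg (J i)),
  args i = subst (fun j => Var (f j)) U := projT2 (cid (IH i)).
pose f i := projT1 (cid (IH1 i)).
have IH2 i : exists U : term Sg (J i), args i = subst (fun j => Var (f i j)) U
  := projT2 (cid (IH1 i)).
pose U i := projT1 (cid (IH2 i)).
have argsE i : args i = subst (fun j => Var (f i j)) (U i)
  := projT2 (cid (IH2 i)).
exists {i : 'I_(arity s) & J i}, (fun p => f (tag p) (tagged p)).
exists (App s (fun i => subst (fun j => Var (Tagged J j)) (U i))) => /=.
by congr (App s _); apply: funext => i; rewrite argsE subst_subst.
Qed.

End FreeAlgebras.

(** * Coextensive varieties are Pierce varieties *)

(** With [k] the first or the second projection, one term over generators and pairs of closed terms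
    describes both components of an element of [S]. *)
Definition closed_pair_subst (Sg : signature)
    (k : closed_term Sg * closed_term Sg -> closed_term Sg)
    (v : bool + closed_term Sg * closed_term Sg) : term Sg bool :=
  match v with inl b => Var b | inr p => closed_in bool (k p) end.

(** The finitely many pairs occurring in [t] provide the constants: their first components become
    the zeros, their second components the ones. Indices without a pair receive [c]. *)
Lemma Pierce_of_closed_pairs (Sg : signature) (V : variety Sg)
    (t : term Sg (bool + closed_term Sg * closed_term Sg)) :
  (exists c : symb Sg, arity c = 0) ->
  variety_satisfies V (subst (closed_pair_subst fst) t) (Var true) ->
  variety_satisfies V (subst (closed_pair_subst snd) t) (Var false) ->
  Pierce V.
Proof.
move=> /constant_closed_term[c]; have [J [f [U ->]]] := term_finite_support t.
rewrite !subst_subst /= => U1 U2.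
(* The index [None] only serves to make the number of parameters positive. *)
pose pars (k : closed_term Sg * closed_term Sg -> closed_term Sg)
    (i : 'I_#|{: option J}|) :=
  if enum_val i is Some j then if f j is inr p then k p else c else c.
(* Each pair becomes a variable [Uz], so that swapping zeros and ones exchanges its components. *)
pose W := subst (fun j => Var match f j with
                              | inl true => Ux _
                              | inl false => Uy _
                              | inr _ => Uz (enum_rank (Some j))
                              end) U.
have WE k k' : subst_U W (Var true) (Var false)
      (fun i => closed_in bool (pars k i)) (fun i => closed_in bool (pars k' i))
    = subst (fun j => closed_pair_subst k (f j)) U.
  rewrite /subst_U subst_subst; congr (subst _ U); apply: funext => j.
  rewrite /pars; case fj: (f j) => [[]|p] //=.
  by rewrite enum_rankK fj.
exists #|{: option J}|, (pars fst), (pars snd), W.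
by split; rewrite ?WE // card_option.
Qed.

Lemma coextensive_Pierce (Sg : signature) (V : variety Sg) :
  (exists c : symb Sg, arity c = 0) -> coextensive_variety V -> Pierce V.
Proof.
move=> has_constant coext.
pose F := VarietyObj (free_in_variety V bool).
pose gen b : F := class_of (identities V bool) (Var b).
pose F2 : algebra Sg := prod_algebra F F.
pose pt (t : closed_term Sg) : F := eval (of_void F) t.
pose env (v : bool + closed_term Sg * closed_term Sg) : F2 :=
  match v with inl b => (gen b, gen b) | inr p => (pt p.1, pt p.2) end.
have ptE t : pt t = class_of (identities V bool) (closed_in bool t).
  by rewrite -eval_free; congr (eval _ t); apply: funext => -[].
have env1 v : (env v).1 = class_of (identities V bool) (closed_pair_subst fst v).
  by case: v => [//|p]; apply: ptE.
have env2 v : (env v).2 = class_of (identities V bool) (closed_pair_subst snd v).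
  by case: v => [//|p]; apply: ptE.
pose P := range_sub (eval_hom env).
pose Q := range_sub (eval_hom (of_void F)).
pose K := VarietyObj
  (injective_in_variety (@sval_inj _ _ Q) (free_in_variety V bool)).
pose S := VarietyObj (injective_in_variety (@sval_inj _ _ P)
  (prod_in_variety (free_in_variety V bool) (free_in_variety V bool))).
have KS (p : variety_product K K) : P (sval p.1, sval p.2).
  have [[s sE] [t tE]] := (svalP p.1, svalP p.2); rewrite -sE -tE.
  by exists (Var (inr (s, t))).
have f_hom : is_hom (A := variety_product K K) (B := S)
    (fun p => exist P _ (KS p)).
  by move=> s a; apply: sval_inj.
pose f : homomorphism (variety_product K K) S := Homomorphism f_hom.
pose incl : homomorphism K F := subalgebra_incl Q.
(* Essential surjectivity at [f] identifies [S] with a product of two objects under [K]. *)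
have [a [i [j [_ ij]]]] := equivalence_essentially_surjective (coext K K)
  (@Under (variety_category V) (variety_product K K) S f).
pose b : prod_category (coslice (K : variety_category V))
                       (coslice (K : variety_category V)) :=
  (@Under (variety_category V) K F incl, @Under (variety_category V) K F incl).
pose T := times_functor (variety_products V) K K.
(* The inclusion of [S] into [F * F], read through [i], is an arrow under [K * K]; by fullness it is
   a product of homomorphisms [g1] and [g2]. *)
pose h : homomorphism _ F2 := comp_hom (subalgebra_incl P) (sval i).
have hP : comp (h : hom (under_obj (T a)) (under_obj (T b))) (under_arr (T a))
    = under_arr (T b).
  apply: homomorphism_eq => p /=.
  by have /= -> := variety_hom_app (svalP i) p.
have [[g1 g2] gh] := equivalence_full (coext K K)
  (exist (fun h => comp h (under_arr (T a)) = under_arr (T b)) _ hP).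
have hE p : h p = (hom_fun (sval g1) p.1, hom_fun (sval g2) p.2).
  by rewrite -(variety_hom_app (congr1 sval gh) p).
have hj s : h (hom_fun (sval j) s) = sval s.
  by have /= -> := variety_hom_app (congr1 sval ij) s.
pose x b0 : S := range_hom (eval_hom env) (Var (inl b0)).
have := hj (x true); have := hj (x false); rewrite !hE => -[_ gy] [gx _].
(* Mixing the coordinates of [(x, x)] and [(y, y)] gives a point that [h] sends to [(x, y)], which
   therefore lies in [S]. *)
pose p := ((hom_fun (sval j) (x true)).1, (hom_fun (sval j) (x false)).2).
have [t tp] : exists t, eval env t = h p := svalP (hom_fun (sval i) p).
have := tp; rewrite hE /= gx gy eval_prod => -[tx ty].
apply: (Pierce_of_closed_pairs (t := t) has_constant).
- by apply/(class_ofP (identities V bool)); rewrite -eval_free -(funext env1).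
- by apply/(class_ofP (identities V bool)); rewrite -eval_free -(funext env2).
Qed.

Theorem corollary2 (Sg : signature) (V : variety Sg)
    (has_constant : exists c : symb Sg, arity c = 0)
    (S_SI_DI : forall A : algebra Sg,
       class_S (SI_members V) A -> DI_members V A) :
  Pierce V <-> coextensive_variety V.
Proof.
split; first exact: Pierce_coextensive.
exact: coextensive_Pierce.
Qed.
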